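(* Let $n\ge 1$ and let $\mathfrak{g}=\mathfrak{osp}(1,2n)$. For all homogeneous $X_1,\ldots,X_{4n+2}\in\mathfrak{g}$ one has \[\mathcal{A}_{4n+2}(X_1,\ldots,X_{4n+2})=\sum_{\sigma\in\mathfrak{S}_{4n+2}}\epsilon(\sigma)\,\epsilon(\sigma,\mathcal{X})\,X_{\sigma(1)}X_{\sigma(2)}\cdots X_{\sigma(4n+2)}=0 .\] (Equivalently, since $\mathcal{A}_{4n+2}$ is multilinear, it vanishes identically on $\mathfrak{g}^{4n+2}$.)
   Context: Let $V=V_{\bar 0}\oplus V_{\bar 1}$ be a $\mathbb{Z}_2$-graded complex vector space with $\dim V_{\bar 0}=1$, $\dim V_{\bar 1}=2n$, and let $\mathfrak{gl}(1,2n)=\mathrm{End}(V)$ with its natural $\mathbb{Z}_2$-grading and super commutator bracket $[X,Y]=XY-(-1)^{xy}YX$ (lower-case letters denote degrees of homogeneous elements). Let $\beta$ be an even nondegenerate bilinear form on $V$ that is symmetric on $V_{\bar 0}$, symplectic (skew) on $V_{\bar 1}$, with $\beta(V_{\bar 0},V_{\bar 1})=0$. Then $\mathfrak{osp}(1,2n)$ is the sub-superalgebra of $\mathfrak{gl}(1,2n)$ spanned by the homogeneous $X$ with $\beta(XY,Z)+(-1)^{xy}\beta(Y,XZ)=0$ for all homogeneous $Y,Z\in V$. Products $X_{\sigma(1)}\cdots X_{\sigma(k)}$ are compositions of endomorphisms of $V$. For $\mathcal{X}=(X_1,\ldots,X_k)$ homogeneous and $\sigma\in\mathfrak{S}_k$,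 $\epsilon(\sigma)$ is the usual sign and $\epsilon(\sigma,\mathcal{X})=(-1)^{K(\sigma,\mathcal{X})}$, where $K(\sigma,\mathcal{X})$ is the number of pairs $(i,j)$ with $i<j$, $\sigma(i)>\sigma(j)$ and both $X_{\sigma(i)},X_{\sigma(j)}$ odd. *)

(* Defs.v *)
From HB Require Import structures.
From mathcomp Require Import all_boot all_order all_algebra all_fingroup.
From mathcomp Require Import complex.
From mathcomp Require Import Rstruct.
Set Implicit Arguments. Unset Strict Implicit. Unset Printing Implicit Defensive.
Import Order.TTheory GRing.Theory Num.Theory.
Local Open Scope ring_scope.

Definition CC : Type := (Rdefinitions.R)[i].

(* V = C^{1+2n}; basis index 0 spans V_0 (even), indices 1..2n span V_1 (odd).
   parity i = true  iff  the i-th basis vector is odd. *)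
Definition parity (N : nat) (i : 'I_N) : bool := (nat_of_ord i != 0)%N.

Definition homog_mx (N : nat) (d : bool) (X : 'M[CC]_N) : Prop :=
  forall i j : 'I_N, parity i (+) parity j != d -> X i j = 0.

Definition homog_vec (N : nat) (d : bool) (v : 'cV[CC]_N) : Prop :=
  forall i : 'I_N, parity i != d -> v i 0 = 0.

Definition bform (N : nat) (B : 'M[CC]_N) (u v : 'cV[CC]_N) : CC :=
  ((u^T *m B *m v) 0 0).

Definition osp_form (N : nat) (B : 'M[CC]_N) : Prop :=
  [/\ forall i j : 'I_N, parity i != parity j -> B i j = 0,
      forall i j : 'I_N, ~~ parity i -> ~~ parity j -> B i j = B j i,
      forall i j : 'I_N, parity i -> parity j -> B i j = - B j i
    & \det B != 0].

Definition in_osp (N : nat) (B : 'M[CC]_N) (x : bool) (X : 'M[CC]_N) : Prop :=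
  forall (y z : bool) (Y Z : 'cV[CC]_N), homog_vec y Y -> homog_vec z Z ->
    bform B (X *m Y) Z + (-1) ^+ (x && y) * bform B Y (X *m Z) = 0.

(* K(sigma, X): number of inversions (i<j, sigma i > sigma j) with both
   X_{sigma i}, X_{sigma j} odd; p k = degree of X_k. *)
Definition Kinv (m : nat) (s : 'S_m) (p : 'I_m -> bool) : nat :=
  #|[set ij : 'I_m * 'I_m | [&& (ij.1 < ij.2)%N, (s ij.2 < s ij.1)%N,
                              p (s ij.1) & p (s ij.2)]]|.

Definition superA (N m : nat) (p : 'I_m -> bool) (X : 'I_m -> 'M[CC]_N.+1)
  : 'M[CC]_N.+1 :=
  \sum_(s : 'S_m) ((-1) ^+ odd_perm s * (-1) ^+ Kinv s p) *:
     \prod_(i < m) X (s i).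

(* Main.v *)
(** Take elements [x_k] of an associative algebra [L] with [x_k ^ 2 = 0], commuting
    with each other when both [X_k] and [X_l] are odd and anticommuting otherwise,
    with nonzero product. For [M = sum_k x_k X_k] one gets
    [M ^ (4n+2) = (prod_k x_k) A(X_1, ..., X_(4n+2))], so it suffices that
    [Z = M ^ 2] satisfies [Z ^ (2n+1) = 0]. Now [Z] is an even element of osp(1,2n)
    with supercommuting entries, and all supertraces of its powers vanish, because
    [str (M B) = - str (B M)] for odd powers [B] of [M].

    It remains to prove a Cayley-Hamilton theorem for [Z = [[0, r], [u, Y]]], where
    [r = u^T J]. If [Y] is invertible then [r Y^-1 u = 0] by symmetry, hence
    [Z = P Q] with [P = (r Y^-1 ; 1)] and [Q = (u, Y)], and [Q P] is a 2n x 2n matrix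
    over a commutative ring whose power traces are those of [Z] up to sign. So [Z]
    is annihilated by ['X] times the characteristic polynomial of [Q P], whose
    coefficients are polynomials in the supertraces of [Z] by Newton's identities.
    Since [Y] is nilpotent in our case, we deform it to [Y + s J^-1], multiply by
    [delta = det (J Y + s)], which is monic in [s], to get rid of inverses, cancel
    [delta], and put [s = 0]. *)
Require Import Defs.
From HB Require Import structures.
From mathcomp Require Import all_boot all_order all_algebra all_fingroup.
From mathcomp Require Import complex Rstruct.
From mathcomp Require Import boolp.
From mathcomp Require Import zify.
Import GRing.Theory.
Local Open Scope ring_scope.
Set Implicit Arguments.
Unset Strict Implicit.
Unset Printing Implicit Defensive.

(** * Commutation up to sign, and square-zero generators with prescribed signs *)

Section SignCommutation.
Variable L : nzRingType.
Implicit Types (b c : bool) (x y z : L).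

Definition scomm b x y := x * y = (-1) ^+ b * (y * x).

Lemma scomm_sym b x y : scomm b x y -> scomm b y x.
Proof. by move=> h; rewrite /scomm h signrMK. Qed.

Lemma scommMr b c x y z : scomm b x y -> scomm c x z -> scomm (b (+) c) x (y * z).
Proof.
rewrite /scomm => hy hz.
rewrite mulrA hy -!mulrA hz (mulrA y _ (z * x)) (commr_sign y c : y * _ = _ * y).
by rewrite signr_addb !mulrA.
Qed.

Lemma scommMl b c x y z : scomm b x z -> scomm c y z -> scomm (b (+) c) (x * y) z.
Proof. by move=> hx hy; apply/scomm_sym/scommMr; apply: scomm_sym. Qed.

Lemma scomm_sumr b x (I : Type) (r : seq I) (P : pred I) (f : I -> L) :
  (forall i, P i -> scomm b x (f i)) -> scomm b x (\sum_(i <- r | P i) f i).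
Proof.
by move=> h; rewrite /scomm mulr_sumr mulr_suml mulr_sumr; apply: eq_bigr.
Qed.

Lemma scomm_suml b y (I : Type) (r : seq I) (P : pred I) (f : I -> L) :
  (forall i, P i -> scomm b (f i) y) -> scomm b (\sum_(i <- r | P i) f i) y.
Proof. by move=> h; apply/scomm_sym/scomm_sumr => i /h/scomm_sym. Qed.

Lemma signr_mulACA b c x y : ((-1) ^+ b * x) * ((-1) ^+ c * y) = (-1) ^+ (b (+) c) * (x * y).
Proof. by rewrite -!mulrA (mulrA x) (commr_sign x c : x * _ = _ * x) signr_addb !mulrA. Qed.

Lemma scomm0r b x : scomm b x 0.
Proof. by rewrite /scomm mul0r !mulr0. Qed.

Lemma scomm0l b x : scomm b 0 x.
Proof. by rewrite /scomm mul0r !mulr0. Qed.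

End SignCommutation.

Lemma scomm_scale (F : fieldType) (L : algType F) b (x y : L) (k l : F) :
  scomm b x y -> scomm b (k *: x) (l *: y).
Proof.
rewrite /scomm => h.
by rewrite -!scalerAl -!scalerAr h !scalerA mulrC.
Qed.

(* Keeps the dimension in successor form, so that the ring structure of square
   matrices is inferred. *)
Section TwoByTwoBlocks.
Variables (R : nzRingType) (d : nat).
Implicit Types A B C D : 'M[R]_d.+1.

Definition dblock_mx A B C D : 'M[R]_((d + d.+1).+1) :=
  @block_mx R d.+1 d.+1 d.+1 d.+1 A B C D.

Lemma dblock_mxM A B C D A' B' C' D' :
  dblock_mx A B C D * dblock_mx A' B' C' D' =
  dblock_mx (A * A' + B * C') (A * B' + B * D') (C * A' + D * C') (C * B' + D * D').
Proof. exact: (@mulmx_block R d.+1 d.+1 d.+1 d.+1 d.+1 d.+1). Qed.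

Lemma dblock_mx0 : dblock_mx 0 0 0 0 = 0.
Proof. exact: (@block_mx0 R d.+1 d.+1 d.+1 d.+1). Qed.

Lemma dblock_mx1 : dblock_mx 1 0 0 1 = 1.
Proof. by rewrite /dblock_mx -[1 in LHS]/(1%:M) -scalar_mx_block. Qed.

Lemma dblock_mxN A B C D : - dblock_mx A B C D = dblock_mx (- A) (- B) (- C) (- D).
Proof. exact: (@opp_block_mx R d.+1 d.+1 d.+1 d.+1). Qed.

Lemma dblock_mx_inj_ur A B C D A' B' C' D' :
  dblock_mx A B C D = dblock_mx A' B' C' D' -> B = B'.
Proof. by move=> h; have [] := @eq_block_mx _ d.+1 d.+1 d.+1 d.+1 _ _ _ _ _ _ _ _ h. Qed.

End TwoByTwoBlocks.

(* A generator [e] is adjoined to a color algebra by passing to 2 x 2 matrices: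
   [e] is the matrix unit [E_12] and [xi_i] becomes [diag (xi_i, +/- xi_i)]. *)
Lemma color_algebra (F : fieldType) (c : nat -> nat -> bool) (m : nat) :
  (forall i j, c i j = c j i) ->
  exists d, exists xi : nat -> 'M[F]_d.+1,
  [/\ forall i, (i < m)%N -> xi i * xi i = 0,
      forall i j, (i < m)%N -> (j < m)%N -> scomm (c i j) (xi i) (xi j)
    & \prod_(i < m) xi i != 0].
Proof.
move=> csym; elim: m => [|m [d [xi [sq0 com pn0]]]].
  by exists 0%N, (fun=> 0); split=> //; rewrite big_ord0 oner_eq0.
pose e : 'M[F]_((d + d.+1).+1) := dblock_mx 0 1 0 0.
pose up i := dblock_mx (xi i) 0 0 ((-1) ^+ c i m * xi i).
exists (d + d.+1)%N, (fun i => if (i < m)%N then up i else e).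
have dblock_mx_sign (b : bool) (A B C D : 'M[F]_d.+1) :
    (-1) ^+ b * dblock_mx A B C D = dblock_mx ((-1) ^+ b * A) ((-1) ^+ b * B)
      ((-1) ^+ b * C) ((-1) ^+ b * D).
  by rewrite !mulr_sign dblock_mxN; case: b.
pose simp := (dblock_mxM, mul0r, mulr0, addr0, add0r, mul1r, mulr1).
have ee : e * e = 0 by rewrite /e !simp dblock_mx0.
have eup i : scomm (c i m) (up i) e.
  by rewrite /scomm /up /e !simp dblock_mx_sign !simp signrMK.
have upup i j : up i * up j =
    dblock_mx (xi i * xi j) 0 0 ((-1) ^+ (c i m (+) c j m) * (xi i * xi j)).
  by rewrite /up !simp signr_mulACA.
split.
- move=> i; rewrite ltnS leq_eqVlt.
  case: ltngtP => // im _.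
  by rewrite upup sq0 // mulr0 dblock_mx0.
- move=> i j; rewrite !ltnS (leq_eqVlt i) (leq_eqVlt j).
  case/predU1P => [->|im]; case/predU1P => [->|jm]; rewrite ?ltnn ?im ?jm.
  + by rewrite /scomm ee mulr0.
  + by rewrite csym; apply/scomm_sym/eup.
  + exact: eup.
  + rewrite /scomm !upup dblock_mx_sign !simp com // !mulrA.
    by rewrite -!signr_addb (addbC (c i j)) (addbC (c j m)).
- rewrite big_ord_recr /= ltnn.
  under eq_bigr do rewrite ltn_ord.
  (* The upper left block is the old product, and multiplication by [e] moves it to the upper right
     corner, so nonvanishing is inherited. *)
  have [Q ->] : exists Q, \prod_(i < m) up i = dblock_mx (\prod_(i < m) xi i) 0 0 Q.
    elim: (m) => [|k [Q IH]]; first by exists 1; rewrite !big_ord0 dblock_mx1.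
    exists (Q * ((-1) ^+ c k m * xi k)); rewrite !big_ord_recr /= IH.
    by rewrite /up !simp.
  rewrite /e !simp; apply: contraNneq pn0 => h.
  by move: h; rewrite -dblock_mx0 => /dblock_mx_inj_ur ->.
Qed.

(** * Signs of reordered products, and the expansion of a power of a sum *)

Section SignOfReordering.
Variable L : nzRingType.

(** [x j] is carried past the [j] factors of smaller index. Each crossing costs a sign, which gives
    [j] in the exponent; the sum takes the sign back where [c] holds. *)
Lemma mul_prod_lift m (j : 'I_m.+1) (c : 'I_m.+1 -> bool) (x : 'I_m.+1 -> L) :
  (forall k, scomm (~~ c k) (x j) (x k)) ->
  x j * \prod_(i < m) x (lift j i) =
  (-1) ^+ (j + \sum_(i < m) ((lift j i < j)%N && c (lift j i))) *
  \prod_(i < m.+1) x i.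
Proof.
elim: m j c x => [|m IH] j c x h.
  by rewrite (ord1 j) !big_ord0 big_ord_recl big_ord0 mul1r.
have [j'|] := unliftP ord0 j => jE; last first.
  rewrite jE [\prod_(i < m.+2) x i]big_ord_recl.
  by rewrite [X in (ord0 + X)%N]big1 ?mul1r // => i _; rewrite ltn0.
have lift0 : lift j ord0 = ord0 by apply: val_inj; rewrite jE.
have liftS i : lift j (lift ord0 i) = lift ord0 (lift j' i).
  by apply: val_inj; rewrite jE /= /bump !leq0n !add1n ltnS addnS.
rewrite big_ord_recl lift0 mulrA h -!mulrA.
under eq_bigr do rewrite liftS.
rewrite jE (IH j' (c \o lift ord0) (x \o lift ord0)); last first.
  by move=> k /=; rewrite -jE; apply: h.
rewrite [\prod_(i < m.+2) x i]big_ord_recl -jE [X in (j + X)%N]big_ord_recl lift0.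
under [X in (_ = (-1) ^+ (_ + (_ + X)) * _)]eq_bigr do rewrite liftS.
rewrite (mulrA (x ord0)) (commr_sign _ _ : x ord0 * _ = _ * x ord0) -!mulrA.
rewrite mulrA -exprD; congr (_ * _).
rewrite -[LHS]signr_odd -[RHS]signr_odd; congr (_ ^+ nat_of_bool _).
rewrite jE /= /bump leq0n !oddD /= !oddb.
by case: (c _); case: (odd j'); case: (odd _).
Qed.

(** Induction on [m]: the first factor is carried to its place by [mul_prod_lift], and the others
    are sorted by the permutation [t] that [s] induces on the remaining indices. The crossings of
    the first factor account for the parity of [s] relative to [t], those between two odd factors
    for the difference of the two [Kinv]. *)
Lemma prod_perm m (p : 'I_m -> bool) (x : 'I_m -> L) (s : 'S_m) :
  (forall k l, scomm (~~ (p k && p l)) (x k) (x l)) ->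
  \prod_(i < m) x (s i) =
  (-1) ^+ odd_perm s * (-1) ^+ Kinv s p * \prod_(i < m) x i.
Proof.
have KinvE n (t : 'S_n) q : Kinv t q =
    (\sum_(i < n) \sum_(k < n) [&& (i < k)%N, (t k < t i)%N, q (t i) & q (t k)])%N.
  rewrite /Kinv cardsE -sum1_card pair_big /= big_mkcond /=.
  by apply: eq_bigr => -[i k] _ /=; rewrite unfold_in /=; case: ifP.
elim: m p x s => [|m IH] p x s h.
  rewrite !big_ord0 mulr1 KinvE big_ord0 mulr1.
  by have -> : s = 1%g by [apply/permP => -[]]; rewrite odd_perm1.
pose j := s ord0.
have sj i : s (lift ord0 i) != j by rewrite (inj_eq perm_inj) eq_sym neq_lift.
have t_ex i : {k | s (lift ord0 i) = lift j k}.
  by case: (unliftP j (s (lift ord0 i))) (sj i) => [k ->|->]; [exists k|rewrite eqxx].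
pose t0 i := sval (t_ex i).
have t0E i : s (lift ord0 i) = lift j (t0 i) by rewrite /t0; case: (t_ex i).
have t0inj : injective t0.
  by move=> a b /(congr1 (lift j)); rewrite -!t0E => /perm_inj/lift_inj.
pose t := perm t0inj.
have tE i : s (lift ord0 i) = lift j (t i) by rewrite t0E permE.
have sE : s = lift_perm ord0 j t.
  apply/permP => i; case: (unliftP ord0 i) => [k ->|->].
    by rewrite tE lift_perm_lift.
  by rewrite lift_perm_id.
rewrite big_ord_recl -/j; under eq_bigr do rewrite tE.
rewrite (IH (p \o lift j) (x \o lift j)); last by move=> k l; apply: h.
have K_s : Kinv s p =
    (\sum_(i < m) ((lift j i < j)%N && (p j && p (lift j i))) + Kinv t (p \o lift j))%N.
  rewrite !KinvE big_ord_recl; congr (_ + _)%N.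
    rewrite big_ord_recl /= add0n -/j [RHS](reindex_inj (@perm_inj _ t)) /=.
    by apply: eq_bigr => i _; rewrite tE.
  apply: eq_bigr => i _; rewrite big_ord_recl /= add0n.
  by apply: eq_bigr => k _; rewrite !tE /= !(ltnNge (bump _ _)) !leq_bump2 -!ltnNge.
rewrite -!exprD mulrA (commr_sign (x j) _ : x j * _ = _ * x j) -mulrA.
rewrite (mul_prod_lift (c := fun k => p j && p k)) // mulrA -exprD.
congr (_ * _); rewrite -[LHS]signr_odd -[RHS]signr_odd; congr (_ ^+ nat_of_bool _).
rewrite K_s sE odd_lift_perm /= !oddD !oddb.
by case: (odd_perm t); case: (odd j); case: (odd (Kinv _ _)); case: (odd _).
Qed.

End SignOfReordering.

Section SuperExpansion.
Variables (F : fieldType) (L : algType F).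

(** The pure tensor of [x] and [A] in the ordinary, unsigned tensor product; all signs come from the
    commutation of the [x]. *)
Definition tens N (x : L) (A : 'M[F]_N.+1) : 'M[L]_N.+1 := \matrix_(i, j) (A i j *: x).

Lemma tensM N x y (A B : 'M[F]_N.+1) : tens x A * tens y B = tens (x * y) (A * B).
Proof.
apply/matrixP => i j; rewrite !mxE scaler_suml; apply: eq_bigr => k _.
by rewrite !mxE -scalerAl -scalerAr scalerA.
Qed.

Lemma tens1 N : tens 1 (1 : 'M[F]_N.+1) = 1.
Proof. by apply/matrixP => i j; rewrite !mxE; case: eqP; rewrite ?scale1r ?scale0r. Qed.

Lemma tens_prod N m (x : 'I_m -> L) (A : 'I_m -> 'M[F]_N.+1) :
  \prod_(i < m) tens (x i) (A i) = tens (\prod_(i < m) x i) (\prod_(i < m) A i).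
Proof.
elim: m x A => [|m IH] x A; first by rewrite !big_ord0 tens1.
by rewrite !big_ord_recl IH tensM.
Qed.

Lemma tens_sum N x (I : Type) (r : seq I) (A : I -> 'M[F]_N.+1) :
  \sum_(i <- r) tens x (A i) = tens x (\sum_(i <- r) A i).
Proof.
apply/matrixP => i j; rewrite !mxE !summxE scaler_suml.
by apply: eq_bigr => k _; rewrite !mxE.
Qed.

Lemma tensZ N (a : F) x (A : 'M[F]_N.+1) : tens (a *: x) A = tens x (a *: A).
Proof. by apply/matrixP => i j; rewrite !mxE scalerA mulrC. Qed.

(** Up to sign, a factor can be moved next to its second occurrence, where it squares to zero. *)
Lemma prod_not_uniq (I : eqType) (x : I -> L) (c : I -> I -> bool) (s : seq I) :
  (forall i, x i * x i = 0) -> (forall i j, scomm (c i j) (x i) (x j)) ->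
  ~~ uniq s -> \prod_(i <- s) x i = 0.
Proof.
move=> sq0 com; have mem0 k l : k \in l -> x k * \prod_(i <- l) x i = 0.
  elim: l => // j l IH; rewrite inE big_cons mulrA => /predU1P[->|kl].
    by rewrite sq0 mul0r.
  by rewrite com -!mulrA IH // !mulr0.
elim: s => // k s IH; rewrite /= negb_and negbK big_cons => /orP[/mem0 //|/IH ->].
by rewrite mulr0.
Qed.

(** The power expands into one term per self-map of the index set. Maps that are not injective die
    by [prod_not_uniq]; for a permutation, sorting the [x] yields exactly the sign of [superA]. *)
Lemma expr_sum_tens N m (p : 'I_m -> bool) (X : 'I_m -> 'M[F]_N.+1) (x : 'I_m -> L) :
  (forall k, x k * x k = 0) ->
  (forall k l, scomm (~~ (p k && p l)) (x k) (x l)) ->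
  (\sum_k tens (x k) (X k)) ^+ m =
  tens (\prod_k x k) (\sum_(s : 'S_m) ((-1) ^+ odd_perm s * (-1) ^+ Kinv s p) *:
     \prod_(i < m) X (s i)).
Proof.
move=> sq0 com; rewrite -tens_sum.
rewrite -[X in _ ^+ X](card_ord m) -prodr_const bigA_distr_bigA.
rewrite (bigID (fun f : {ffun _ -> _} => injectiveb f)) /= addrC big1 ?add0r => [|f]; last first.
  move=> finj; rewrite tens_prod.
  have -> : \prod_i x (f i) = 0.
    rewrite -(big_map f xpredT x); apply: (prod_not_uniq sq0 com).
    by rewrite [index_enum _]unlock -enumT.
  by apply/matrixP => i j; rewrite !mxE scaler0.
rewrite (reindex (@pval _)) /=; last first.
  (* The inverse of [pval] on injective functions; elsewhere the identity is a default value. *)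
  pose in_Sn := insubd (1%g : 'S_m).
  by exists in_Sn => /= f Uf; first apply: val_inj; apply: insubdK.
apply: eq_big => /= [s | s _]; first by rewrite (valP s).
rewrite pvalE tens_prod (prod_perm s com) -tensZ; congr tens.
by rewrite -!exprD -[in LHS]signr_odd -[in RHS]signr_odd mulr_sign scaler_sign.
Qed.
End SuperExpansion.

(** * Newton's identities for the characteristic polynomial *)

Section Newton.
Variable K : comNzRingType.

Lemma deriv_prod (I : finType) (f : I -> {poly K}) :
  (\prod_i f i)^`() = \sum_i (f i)^`() * \prod_(j | j != i) f j.
Proof.
suff gen (r : seq I) : uniq r ->
    (\prod_(i <- r) f i)^`() = \sum_(i <- r) (f i)^`() * \prod_(j <- r | j != i) f j.
  exact/gen/index_enum_uniq.
elim: r => [_|k r IH /= /andP[kr ur]]; first by rewrite !big_nil derivC.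
rewrite !big_cons derivM IH // eqxx /= mulr_sumr; congr (_ * _ + _).
  rewrite [RHS]big_seq_cond [LHS]big_seq; apply: eq_bigl => i.
  by case: (boolP (i \in r)) => //= ir; apply/esym/(memPn kr).
rewrite !big_seq; apply: eq_bigr => i ir; rewrite big_cons.
by rewrite eq_sym (memPn kr _ ir) mulrCA.
Qed.

(** Jacobi's formula for a matrix whose derivative is the identity. In the Leibniz expansion, only
    factors with [s i = i] have a nonzero derivative, and these terms make up the diagonal
    cofactors. *)
Lemma deriv_char_poly n (T : 'M[K]_n) : (char_poly T)^`() = \tr (\adj (char_poly_mx T)).
Proof.
rewrite /mxtrace; under [RHS]eq_bigr do rewrite mxE expand_cofactor.
rewrite (exchange_big_dep xpredT) //= /char_poly /determinant raddf_sum /=.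
apply: eq_bigr => s _; rewrite -(rmorph_sign polyC) deriv_mulC deriv_prod mulr_sumr.
rewrite [RHS]big_mkcond; apply: eq_bigr => i _.
rewrite !mxE derivB derivC subr0 derivMn derivX eq_sym.
case: eqP => _; last by rewrite mul0r mulr0.
by rewrite mul1r; congr (_ * _); apply: eq_bigl => k; rewrite eq_sym.
Qed.

(* The bound [m] only has to be large: the summands with [j + i > n + 1] vanish. *)
Lemma newton_char_poly n (T : 'M[K]_n.+1) : exists m, forall j,
  \sum_(i < m.+1) (char_poly T)`_(j + i) * \tr (T ^+ i) = (char_poly T)`_j *+ j.
Proof.
set c := char_poly T; set A := \adj (char_poly_mx T).
pose B j : 'M[K]_n.+1 := map_mx (coefp j) A.
(* Coefficient of degree [j.+1] in [adj (X - T) (X - T) = c]. *)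
have B_step j : B j = (c`_j.+1)%:M + B j.+1 *m T.
  have /matrixP e := mul_adj_mx (char_poly_mx T).
  apply/matrixP => a b; have := congr1 (coefp j.+1) (e a b).
  rewrite mulmxBr mul_mx_scalar !mxE /= coefB coefXM /= coefMn => /(canRL (subrK _)) ->.
  by congr (_ + _); rewrite coef_sum; apply: eq_bigr => k _; rewrite !mxE coefMC.
have B_iter m j : \tr (B j) =
    \sum_(i < m) c`_(j.+1 + i) * \tr (T ^+ i) + \tr (B (j + m)%N *m T ^+ m).
  elim: m => [|m ->]; first by rewrite big_ord0 add0r addn0 mulmx1.
  rewrite big_ord_recr /= -addrA (B_step (j + m)%N) mulmxDl mxtraceD mul_scalar_mx mxtraceZ.
  by rewrite -mulmxA -[T *m _]exprS addnS addSn.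
pose m := (\max_(i < n.+1) \max_(j < n.+1) size (A i j) + n.+2)%N.
have B0 j : B (j + m.+1)%N = 0.
  apply/matrixP => a b; rewrite [LHS]mxE [RHS]mxE /= nth_default //.
  have h1 := @leq_bigmax _ (fun j => size (A a j)) b.
  have h2 := @leq_bigmax _ (fun i => \max_(j < n.+1) size (A i j)) a.
  by rewrite addnS; apply/leqW/(leq_trans h1)/(leq_trans h2);
    rewrite (leq_trans (leq_addr _ _) (leq_addl _ _)).
(* Index 0 is the trace of the Cayley-Hamilton identity. Positive indices come from the derivative
   of [c], with [\tr (B j)] unrolled by [B_iter]. *)
exists m => -[|j].
  have : horner_mx T c = 0 := Cayley_Hamilton T.
  rewrite -{1}(coefK c) poly_def size_char_poly raddf_sum => /(congr1 mxtrace) /=.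
  rewrite mxtrace0 raddf_sum /= => CH.
  rewrite mulr0n -[RHS]CH; transitivity (\sum_(i < n.+2) c`_i * \tr (T ^+ i)).
    have nm : (n.+2 <= m.+1)%N by rewrite leqW // leq_addl.
    rewrite (big_ord_widen m.+1 (fun i => c`_i * \tr (T ^+ i)) nm) [RHS]big_mkcond.
    apply: eq_bigr => i _; rewrite add0n; case: ltnP => // ni.
    by rewrite [c`_i]nth_default ?mul0r // /c size_char_poly.
  by apply: eq_bigr => i _; rewrite linearZ /= rmorphXn /= horner_mx_X mxtraceZ.
have -> : c`_j.+1 *+ j.+1 = \tr (B j).
  rewrite -coef_deriv deriv_char_poly coef_sum.
  by apply: eq_bigr => i _; rewrite [RHS]mxE.
by rewrite (B_iter m.+1 j) B0 mul0mx mxtrace0 addr0.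
Qed.

End Newton.

(** By Newton's identities the coefficient in degree [n + 1 - k] is a polynomial in the power
    traces, homogeneous of weight [k]. Hence [delta ^+ k] factors out, and for positive [k] every
    monomial contains some [q], which [ev] kills. *)
Lemma char_poly_coef_divisible (K K0 : comNzRingType) (ev : {rmorphism K -> K0}) n
    (T : 'M[K]_n.+1) (delta : K) (q : nat -> K) :
  (forall k, exists v, k.+1%:R * v = 1 :> K) ->
  (forall k, \tr (T ^+ k.+1) = delta ^+ k.+1 * q k.+1) ->
  (forall k, ev (q k.+1) = 0) ->
  forall k, (k <= n.+1)%N ->
  exists2 g, (char_poly T)`_(n.+1 - k) = delta ^+ k * g & ev g = (k == 0)%:R.
Proof.
move=> nat_unit trT evq k; have [m newton] := newton_char_poly T.
elim/ltn_ind: k => -[_ _|k IH kn].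
  exists 1; rewrite ?rmorph1 // subn0 mul1r.
  by have /monicP := char_poly_monic T; rewrite /lead_coef size_char_poly.
set c := char_poly T in newton IH *.
pose P x := exists2 h, x = delta ^+ k.+1 * h & ev h = 0.
have [h sumE evh] : P (\sum_(i < m) c`_(n.+1 - k.+1 + i.+1) * \tr (T ^+ i.+1)).
  apply: big_ind => [|x y [a -> ea] [b -> eb]|i _].
  - by exists 0; rewrite ?mulr0 ?rmorph0.
  - by exists (a + b); rewrite ?mulrDr // rmorphD /= ea eb addr0.
  (* For [i] beyond [k] the coefficient index exceeds the degree [n.+1]. *)
  rewrite trT; case: (leqP i k) => ik; last first.
    exists 0; last exact: rmorph0.
    by rewrite nth_default ?mul0r ?mulr0 // size_char_poly; lia.
  have -> : (n.+1 - k.+1 + i.+1 = n.+1 - (k - i))%N by lia.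
  have [||g -> _] := IH (k - i)%N; [lia|lia|].
  exists (g * q i.+1); last by rewrite rmorphM /= evq mulr0.
  by rewrite mulrACA -exprD; congr (_ ^+ _ * _); lia.
have := newton (n.+1 - k.+1)%N; rewrite big_ord_recl addn0 expr0 mxtrace1 mulr_natr.
under eq_bigr do rewrite lift0.
rewrite sumE => e.
(* The trace of the identity counts the coefficient [n + 1] times, the right-hand side of Newton's
   identity [n - k] times; the difference [k + 1] is invertible. *)
have {e} e : c`_(n.+1 - k.+1) * k.+1%:R = delta ^+ k.+1 * - h.
  have nk : n.+1 = (n.+1 - k.+1 + k.+1)%N by lia.
  move: e; rewrite {2}nk mulrnDr -addrA => /(canRL (addKr _)).
  by rewrite addNr mulrN mulr_natr => /(canRL (addrK _)); rewrite sub0r.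
have [v v1] := nat_unit k.
exists (- h * v); last by rewrite rmorphM rmorphN /= evh oppr0 mul0r.
by rewrite mulrA -e -mulrA v1 mulr1.
Qed.

(** * Commutative hull of a commuting family *)

(* The double centralizer of a commuting family is a commutative ring that
   contains it; determinants of matrices with entries in the family live there. *)
Section DoubleCentralizer.
Variables (L : nzRingType) (E : L -> Prop).

Definition centralizes (x : L) := forall e, E e -> GRing.comm x e.

Definition bicentral : {pred L} :=
  fun x => `[< forall y, centralizes y -> GRing.comm x y >].

Lemma bicentralP x : reflect (forall y, centralizes y -> GRing.comm x y) (x \in bicentral).
Proof. exact: asboolP. Qed.

Lemma bicentral_subring : subring_closed bicentral.
Proof.
split=> [|x y /bicentralP hx /bicentralP hy|x y /bicentralP hx /bicentralP hy];
  apply/bicentralP => z hz; apply: commr_sym.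
- exact: commr1.
- by apply: commrB; apply: commr_sym; [apply: hx|apply: hy].
- by apply: commrM; apply: commr_sym; [apply: hx|apply: hy].
Qed.

HB.instance Definition _ := GRing.isSubringClosed.Build L bicentral bicentral_subring.

(** The proof [Ecomm] is a parameter of the type so that the commutative ring structure can be
    attached to it. *)
Definition bicentralizer (Ecomm : forall x, E x -> centralizes x) :=
  {x : L | x \in bicentral}.

Hypothesis Ecomm : forall x, E x -> centralizes x.
HB.instance Definition _ := SubChoice.on (bicentralizer Ecomm).
HB.instance Definition _ := [SubChoice_isSubNzRing of (bicentralizer Ecomm) by <:].

(** A commuting family lies in its own centralizer, so bicentral elements centralize the family and
    therefore commute with one another. *)
Lemma bicentralizer_mulC : @commutative (bicentralizer Ecomm) _ *%R.
Proof.
move=> [x xP] [y yP]; apply: val_inj => /=.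
move/bicentralP: (xP); apply=> e /Ecomm ce.
by move/bicentralP: yP; apply.
Qed.
HB.instance Definition _ :=
  GRing.PzRing_hasCommutativeMul.Build (bicentralizer Ecomm) bicentralizer_mulC.

End DoubleCentralizer.

(** The last clause serves the entries of the odd vector [u], which commute with the family but
    anticommute among themselves. *)
Lemma commutative_hull (L : nzRingType) (E : L -> Prop) :
  (forall x y, E x -> E y -> GRing.comm x y) ->
  exists (K : comNzRingType) (f : {rmorphism K -> L}),
  [/\ injective f, forall e, E e -> exists k, f k = e
    & forall x, (forall e, E e -> GRing.comm x e) -> forall k, GRing.comm x (f k)].
Proof.
move=> Ec; have Ecomm x : E x -> centralizes E x by move=> Ex y; apply: Ec.
exists (bicentralizer Ecomm), (\val : {rmorphism bicentralizer Ecomm -> L}); split.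
- exact: val_inj.
- move=> e Ee; have eP : e \in bicentral E.
    by apply/bicentralP => y cy; apply/commr_sym/cy.
  by exists (exist _ e eP : bicentralizer Ecomm).
- by move=> x cx [k /bicentralP kP] /=; apply/commr_sym/kP.
Qed.

(** * Supertraces and the super Cayley-Hamilton theorem *)

Definition strace (R : nzRingType) n (W : 'M[R]_n.+1) : R :=
  W ord0 ord0 - \sum_(i < n) W (lift ord0 i) (lift ord0 i).

Lemma strace_block (R : nzRingType) n (a : 'M[R]_1) b c (d : 'M[R]_n) :
  strace (block_mx a b c d : 'M_(1 + n)) = a 0 0 - \tr d.
Proof.
congr (_ - _); last by apply: eq_bigr => i _; rewrite -rshift1 (@block_mxEdr _ 1 n 1 n).
have -> : ord0 = lshift n 0 :> 'I_(1 + n) by apply: val_inj.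
exact: block_mxEul.
Qed.

Lemma comm_scalar_mx (R : nzRingType) m n (x : R) (W : 'M[R]_(m, n)) :
  (forall i j, GRing.comm (W i j) x) -> x%:M *m W = W *m x%:M.
Proof.
move=> h; apply/matrixP => i j.
by rewrite mul_scalar_mx -diag_const_mx mul_mx_diag !mxE h.
Qed.

(* [P Q = delta Z] and [Q P = T] are the factorizations of the header with
   [delta = det S] cleared; [S] stands for [J Y + s] and [X] for [Y + s J^-1]. *)
Section SuperCayleyHamilton.
Variables (K : comNzRingType) (L : nzRingType) (f : {rmorphism K -> L}) (n : nat).
Hypothesis f_inj : injective f.
Hypothesis reg2 : forall x : K, x + x = 0 -> x = 0.
Variables (u : 'cV[L]_n.+1) (U J G S : 'M[K]_n.+1).
Hypothesis u_comm : forall i k, GRing.comm (u i 0) (f k).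
Hypothesis fU : forall i j, f (U i j) = u i 0 * u j 0.
Hypotheses (U_skew : U^T = - U) (J_skew : J^T = - J) (S_sym : S^T = S).
Hypothesis JG : J *m G = 1%:M.

Let X := G *m S.
Let delta := \det S.
(** This is [delta] times the inverse of [X], without division. *)
Let a := \adj S *m J.
Let T : 'M[K]_n.+1 := U *m J *m a + delta *: X.
Let Z : 'M[L]_(1 + n.+1) := block_mx 0 (u^T *m map_mx f J) u (map_mx f X).
Let P : 'M[L]_(1 + n.+1, n.+1) := col_mx (u^T *m map_mx f (J *m a)) (map_mx f delta%:M).
Let Q : 'M[L]_(n.+1, 1 + n.+1) := row_mx u (map_mx f X).

Let aX : a *m X = delta%:M.
Proof. by rewrite /a /X mulmxA -(mulmxA _ J) JG mulmx1 mul_adj_mx. Qed.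

Let tr_skew_sym (A : 'M[K]_n.+1) : A^T = A -> \tr (A *m U) = 0.
Proof.
move=> As; apply: reg2; rewrite -{1}mxtrace_tr trmx_mul As U_skew mulNmx raddfN.
by rewrite mxtrace_mulC addNr.
Qed.

Let Ja_sym : (J *m a)^T = J *m a.
Proof.
by rewrite /a mulmxA !trmx_mul trmx_adj S_sym J_skew !(mulmxN, mulNmx) opprK mulmxA.
Qed.

Let uuT : u *m u^T = map_mx f U.
Proof. by apply/matrixP => i j; rewrite !mxE big_ord1 !mxE fU. Qed.

(** The source of the supertrace sign: moving [u] around the trace reverses two odd factors, and [U]
    is skew. *)
Let uTu (B : 'M[K]_n.+1) : u^T *m map_mx f B *m u = (f (- \tr (B *m U)))%:M.
Proof.
rewrite -raddfN -mulmxN -U_skew /=.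
apply/matrixP => i j; rewrite !ord1 !mxE mulr1n /mxtrace.
under eq_bigr do rewrite !mxE mulr_suml.
rewrite exchange_big rmorph_sum; apply: eq_bigr => k _ /=.
rewrite [in RHS]mxE rmorph_sum; apply: eq_bigr => l _ /=.
by rewrite !mxE u_comm -mulrA -fU -rmorphM.
Qed.

Let QP : Q *m P = map_mx f T.
Proof.
rewrite mul_row_col mulmxA uuT -!map_mxM -map_mxD; congr map_mx.
by rewrite /T mulmxA mul_mx_scalar.
Qed.

Let f_commf k l : GRing.comm (f k) (f l).
Proof. by rewrite /GRing.comm -!rmorphM mulrC. Qed.

Let f_comm_row (B : 'M[K]_n.+1) k i j : GRing.comm ((u^T *m map_mx f B) i j) (f k).
Proof.
rewrite mxE; apply/commr_sym/commr_sum => l _; rewrite !mxE (ord1 i).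
by apply: commrM; [apply/commr_sym/u_comm|apply: f_commf].
Qed.

Let f_comm_mx m1 m2 (B : 'M[K]_(m1, m2)) k i j : GRing.comm (map_mx f B i j) (f k).
Proof. by rewrite mxE; apply: f_commf. Qed.

Let P_comm k i j : GRing.comm (P i j) (f k).
Proof.
rewrite /P -(splitK i); case: (split i) => i' /=; first by rewrite col_mxEu.
by rewrite col_mxEd.
Qed.

Let Z_comm k i j : GRing.comm (Z i j) (f k).
Proof.
rewrite /Z -(splitK i) -(splitK j); case: (split i) (split j) => i' [] j' /=.
- by rewrite block_mxEul mxE; apply/commr_sym/commr0.
- by rewrite block_mxEur.
- by rewrite block_mxEdl ord1.
- by rewrite block_mxEdr.
Qed.

Let Q_comm k i j : GRing.comm (Q i j) (f k).
Proof.
rewrite /Q -(splitK j); case: (split j) => j' /=; first by rewrite row_mxEl ord1.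
by rewrite row_mxEr.
Qed.

(** The corner vanishes because [J a] is symmetric and [U] skew; this is [r Y^-1 u = 0] with the
    denominator cleared. *)
Let PQ : P *m Q = (f delta)%:M * Z.
Proof.
rewrite mul_col_row uTu tr_skew_sym // oppr0 rmorph0 -mulmxA -map_mxM -mulmxA aX.
rewrite -[_ * Z]/(_ *m (Z : 'M_(1 + n.+1))) (@scalar_mx_block _ 1 n.+1) /Z mulmx_block.
rewrite !(mulmx0, mul0mx, addr0, add0r) map_scalar_mx; congr block_mx.
- by rewrite raddf0.
- rewrite comm_scalar_mx; last exact: f_comm_row.
  by rewrite mul_mx_scalar -mulmxA -map_scalar_mx -map_mxM mul_mx_scalar.
Qed.

Let PQ_expr k : (P *m Q : 'M_(1 + n.+1)) ^+ k = (f (delta ^+ k))%:M * Z ^+ k.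
Proof.
rewrite PQ exprMn_comm; last exact: (comm_scalar_mx (Z_comm _)).
by rewrite rmorphXn (rmorphXn (@scalar_mx L n.+2)).
Qed.

Let PTQ k : P *m (map_mx f T) ^+ k *m Q = (P *m Q : 'M_(1 + n.+1)) ^+ k.+1.
Proof.
elim: k => [|k IH]; first by rewrite expr0 mulmx1 expr1.
rewrite exprS [RHS]exprS -IH -QP -[(Q *m P) * _]/((Q *m P) *m _) -[X in _ = X]/(_ *m _).
by rewrite !mulmxA.
Qed.

(** The Cayley-Hamilton identity of [T = Q P] between [P] and [Q]: since
    [P T^i Q = (P Q)^(i+1) = (delta Z)^(i+1)], every exponent rises by one. *)
Lemma super_Cayley_Hamilton :
  \sum_(i < n.+2) (f ((char_poly T)`_i * delta ^+ i.+1))%:M * Z ^+ i.+1 = 0.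
Proof.
have : P *m map_mx f (horner_mx T (char_poly T)) *m Q = 0.
  by rewrite Cayley_Hamilton map_mx0 mulmx0 mul0mx.
rewrite -{1}(coefK (char_poly T)) poly_def size_char_poly raddf_sum /= (raddf_sum (map_mx f)) /=.
rewrite mulmx_sumr mulmx_suml => CH; rewrite -[RHS]CH; apply: eq_bigr => i _.
rewrite linearZ /= rmorphXn /= horner_mx_X -mul_scalar_mx map_mxM map_scalar_mx.
rewrite (rmorphXn (map_mx f)) /=.
rewrite mulmxA -comm_scalar_mx // -!mulmxA (mulmxA P) PTQ PQ_expr.
by rewrite rmorphM (rmorphM (@scalar_mx L n.+2)) -mulrA.
Qed.

(** Writing the blocks with coefficients in [K] allows traces to be computed there, where cyclicity
    holds. *)
Let Z_expr_form k : exists y B C D, Z ^+ k =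
  block_mx (f y)%:M (u^T *m map_mx f B) (map_mx f C *m u) (map_mx f D).
Proof.
elim: k => [|k [y [B [C [D ZkE]]]]].
  exists 1, 0, 0, 1%:M.
  by rewrite rmorph1 !map_mx0 mulmx0 mul0mx map_mx1 -(@scalar_mx_block _ 1 n.+1).
exists (- \tr (B *m U)), (y *: J + B *m X), D, (C *m U *m J + D *m X).
rewrite exprSr ZkE -[_ * Z]/(_ *m Z) mulmx_block !mulmx0 !add0r.
congr block_mx.
- exact: uTu.
- rewrite (map_mxD f) map_mxZ mulmxDr comm_scalar_mx; last exact: f_comm_row.
  rewrite -!mulmxA -map_mxM; congr (_ *m _ + _).
  by rewrite -comm_scalar_mx ?mul_scalar_mx //; apply: f_comm_mx.
- by rewrite (map_mxD f) !map_mxM -uuT !mulmxA.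
Qed.

Let T_expr k : map_mx f (T ^+ k.+1) = Q *m ((f (delta ^+ k))%:M * Z ^+ k) *m P.
Proof.
rewrite -PQ_expr; elim: k => [|k IH]; first by rewrite expr0 mulmx1 expr1 QP.
by rewrite exprSr map_mxM IH -QP [in RHS]exprSr -[(P *m Q) ^+ k * _]/(_ *m _) !mulmxA.
Qed.

Let sandwich (X' A B C D : 'M[K]_n.+1) y d :
  (u *m (f y)%:M + map_mx f X' *m (map_mx f C *m u)) *m (u^T *m map_mx f A) +
    (u *m (u^T *m map_mx f B) + map_mx f X' *m map_mx f D) *m map_mx f d%:M =
  map_mx f ((y *: U + X' *m C *m U) *m A + d *: (U *m B + X' *m D)).
Proof.
have uy : u *m (f y)%:M = f y *: u.
  by rewrite -comm_scalar_mx ?mul_scalar_mx // => i j; rewrite ord1; apply: u_comm.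
have WM (W : 'M[K]_n.+1) : map_mx f W *m (f d)%:M = f d *: map_mx f W.
  by rewrite -comm_scalar_mx ?mul_scalar_mx //; apply: f_comm_mx.
rewrite uy (mulmxA u u^T (map_mx f B)) uuT -!map_mxM -map_mxD map_scalar_mx WM.
rewrite (map_mxD f _ (d *: _)) map_mxZ; congr (_ + _).
rewrite (map_mxM f _ A) (map_mxD f) map_mxZ -uuT (map_mxM f _ U) -uuT.
rewrite (mulmxA _ u^T (map_mx f A)) mulmxDl; congr ((_ + _) *m _).
  by rewrite -scalemxAl.
by rewrite map_mxM !mulmxA.
Qed.

(** [T = Q P] and [delta Z = P Q] share their power traces up to the sign of the supertrace. The
    formula [T^(k+1) = delta^k Q Z^k P] only shows [delta ^+ k]; the last factor [delta] appears
    under the trace, from [a X = delta] and the vanishing of [\tr (J a U)]. *)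
Lemma strace_expr k : exists2 q, \tr (T ^+ k.+1) = delta ^+ k.+1 * q & f q = - strace (Z ^+ k.+1).
Proof.
have [y [B [C [D ZkE]]]] := Z_expr_form k.
exists (\tr (B *m U) + \tr (C *m U *m J + D *m X)); last first.
  rewrite exprSr ZkE -[_ * Z]/(_ *m Z) mulmx_block strace_block mulmx0 add0r uTu.
  rewrite mxE mulr1n (mulmxA _ u^T) -(mulmxA _ u) uuT -!map_mxM -map_mxD trace_map_mx.
  by rewrite opprB addrC rmorphN opprK rmorphD !mulmxA.
have -> : T ^+ k.+1 = delta ^+ k *: ((y *: U + X *m C *m U) *m (J *m a)
                                    + delta *: (U *m B + X *m D)).
  suff /matrixP e : map_mx f (T ^+ k.+1) = map_mx f (delta ^+ k *:
      ((y *: U + X *m C *m U) *m (J *m a) + delta *: (U *m B + X *m D))).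
    by apply/matrixP => i j; apply: f_inj; have := e i j; rewrite [LHS]mxE [RHS]mxE.
  rewrite T_expr map_mxZ -mul_scalar_mx -[_ * Z ^+ k]/(_ *m (Z ^+ k)) mulmxA.
  rewrite -[Q *m _]comm_scalar_mx; last exact: Q_comm.
  rewrite -!(mulmxA _%:M); congr (_ *m _); rewrite ZkE mul_row_block mul_row_col.
  exact: sandwich.
rewrite exprSr -mulrA mxtraceZ; congr (_ * _).
rewrite mxtraceD mxtraceZ mulmxDl mxtraceD -scalemxAl mxtraceZ.
rewrite (mxtrace_mulC U (J *m a)) (tr_skew_sym Ja_sym) mulr0 add0r.
have -> : \tr (X *m C *m U *m (J *m a)) = delta * \tr (C *m U *m J).
  rewrite -!(mulmxA X) (mxtrace_mulC X) -(mulmxA _ (J *m a)) -(mulmxA J) aX.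
  by rewrite !mulmxA mul_mx_scalar mxtraceZ.
rewrite -mulrDr !mxtraceD (mxtrace_mulC U) (mxtrace_mulC X).
by rewrite addrCA.
Qed.

(** [evK] and [evL] stand for putting [s = 0]. The supertraces vanish only after specialization, so
    [delta] is cancelled first; specialization then leaves the leading term alone. *)
Lemma super_nilpotent_specialize (K0 : comNzRingType) (L0 : nzRingType)
    (f0 : {rmorphism K0 -> L0}) (evK : {rmorphism K -> K0}) (evL : {rmorphism L -> L0}) :
  injective f0 -> (forall k, evL (f k) = f0 (evK k)) ->
  (forall k, exists v, k.+1%:R * v = 1 :> K) ->
  GRing.lreg (f delta) ->
  (forall k, strace ((map_mx evL Z : 'M_(1 + n.+1)) ^+ k.+1) = 0) ->
  (map_mx evL Z : 'M_(1 + n.+1)) ^+ n.+2 = 0.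
Proof.
move=> f0_inj ev_f nat_unit delta_reg str0.
pose q k := if k is k'.+1 then s2val (cid2 (strace_expr k')) else 0.
have trT k : \tr (T ^+ k.+1) = delta ^+ k.+1 * q k.+1 by rewrite /q /=; case: cid2.
have evq k : evK (q k.+1) = 0.
  apply: f0_inj; rewrite -ev_f rmorph0 /q /=; case: cid2 => x /= _ ->.
  have e : map_mx evL (Z ^+ k.+1) = (map_mx evL Z : 'M_(1 + n.+1)) ^+ k.+1.
    exact: (rmorphXn (map_mx evL)).
  rewrite rmorphN -[RHS]oppr0; congr (- _).
  rewrite -[RHS](str0 k) -e /strace rmorphB rmorph_sum /= [in RHS]mxE; congr (_ - _).
  by apply: eq_bigr => i _; rewrite [RHS]mxE.
have coefE k (kn : (k < n.+2)%N) := char_poly_coef_divisible nat_unit trT evq kn.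
pose g (i : 'I_n.+2) := s2val (cid2 (coefE i (ltn_ord i))).
have gE (i : 'I_n.+2) : (char_poly T)`_(n.+1 - i) = delta ^+ i * g i.
  by rewrite /g; case: cid2.
have evg (i : 'I_n.+2) : evK (g i) = (i == ord0)%:R by rewrite /g; case: cid2.
(* The relation of [super_Cayley_Hamilton] divided by [delta ^+ n.+2], with [i] counted down from
   the top degree. *)
pose W : 'M[L]_(1 + n.+1) := \sum_(i < n.+2) (f (g i))%:M * Z ^+ (n.+2 - i).
have W0 : W = 0.
  have dW : (f (delta ^+ n.+2))%:M * W = 0.
    rewrite -[RHS]super_Cayley_Hamilton (reindex_inj rev_ord_inj) /= mulr_sumr.
    apply: eq_bigr => i _; rewrite !subSS gE mulrA.
    have ni : (i <= n.+1)%N by rewrite -ltnS.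
    rewrite -(rmorphM (@scalar_mx L n.+2)) -rmorphM -subSn //.
    congr (_ * _); congr (_%:M); congr (f _).
    by rewrite [RHS]mulrAC -exprD; congr (_ ^+ _ * _); lia.
  apply/matrixP => i j; have /matrixP/(_ i j) := dW.
  rewrite -[_ * W]/(_ *m W) mul_scalar_mx mxE => e.
  have reg : GRing.lreg (f delta ^+ n.+2) by apply: lregX.
  by rewrite [RHS]mxE; apply: reg; rewrite -rmorphXn /= e mulr0 mxE.
have : map_mx evL W = 0 by rewrite W0 map_mx0.
rewrite (raddf_sum (map_mx evL)) big_ord_recl /= big1 ?addr0 => [|i _].
  by rewrite rmorphM rmorphXn /= map_scalar_mx ev_f evg rmorph1 mul1r.
by rewrite rmorphM /= map_scalar_mx ev_f evg rmorph0 raddf0 mul0r.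
Qed.

End SuperCayleyHamilton.

(** * Nilpotency of the even element, by deformation over polynomials *)

Lemma lift_map_mx (K L : nzRingType) (f : {rmorphism K -> L}) m n (W : 'M[L]_(m, n)) :
  (forall i j, exists k, f k = W i j) -> exists W0, map_mx f W0 = W.
Proof.
move=> h; exists (\matrix_(i, j) sval (cid (h i j))).
by apply/matrixP => i j; rewrite !mxE; case: cid.
Qed.

Lemma comm_polyC_map (K L : nzRingType) (f : {rmorphism K -> L}) (x : L) (k : {poly K}) :
  (forall c, GRing.comm x (f c)) -> GRing.comm x%:P (map_poly f k).
Proof. by move=> h; apply/polyP => i; rewrite coefCM coefMC coef_map /= h. Qed.

(* [E] lists the entries that must become scalars; the deformation takes place
   over [{poly K}], [K] being the double centralizer of [E]. *)
Section OspNilpotent.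
Variables (F : fieldType) (L : algType F) (n : nat).
Hypothesis char0 : [pchar F] =i pred0.
Variables (J G : 'M[F]_n.+1) (u : 'cV[L]_n.+1) (Y : 'M[L]_n.+1).
Local Notation JL := (map_mx (in_alg L) J).
Hypotheses (J_skew : J^T = - J) (JG : J *m G = 1%:M).
Hypothesis u_anti : forall i j, u i 0 * u j 0 = - (u j 0 * u i 0).
Hypothesis uY_comm : forall k i j, GRing.comm (u k 0) (Y i j).
Hypothesis Y_comm : forall i j k l, GRing.comm (Y i j) (Y k l).
Hypothesis JY_sym : (JL *m Y)^T = JL *m Y.

Let E (x : L) :=
  [\/ exists i j, x = Y i j, exists i j, x = u i 0 * u j 0 | exists c, x = in_alg L c].

Let alg_comm x c : GRing.comm x (in_alg L c).
Proof. by rewrite /GRing.comm -scalerAl -scalerAr mul1r mulr1. Qed.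

(** Passing a product of two entries of [u] changes the sign twice. *)
Let uE_comm k e : E e -> GRing.comm (u k 0) e.
Proof.
case=> [[i [j ->]]|[i [j ->]]|[c ->]]; [exact: uY_comm| |exact: alg_comm].
rewrite /GRing.comm mulrA (u_anti k i) mulNr.
by rewrite -(mulrA (u i 0) (u k 0)) (u_anti k j) mulrN opprK mulrA.
Qed.

Let E_comm x y : E x -> E y -> GRing.comm x y.
Proof.
case=> [[i [j ->]]|[i [j ->]]|[c ->]] Ey; last exact/commr_sym/alg_comm.
  case: Ey => [[k [l ->]]|[k [l ->]]|[c ->]]; [exact: Y_comm| |exact: alg_comm].
  by apply: commrM; apply/commr_sym/uY_comm.
by apply/commr_sym/commrM; apply/commr_sym/uE_comm.
Qed.

Let natL_unit k : (k.+1%:R : F) != 0.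
Proof. by have [/(_ char0) -> _] := pcharf0P F. Qed.

Theorem osp_super_nilpotent :
  let Z : 'M[L]_(1 + n.+1) := block_mx 0 (u^T *m JL) u Y in
  (forall k, strace (Z ^+ k.+1) = 0) -> Z ^+ n.+2 = 0.
Proof.
move=> Z str0.
have [K [f [f_inj f_E f_comm]]] := commutative_hull E_comm.
have f_alg c : exists k, f k = in_alg L c by apply: f_E; apply: Or33; exists c.
have [J0 J0E] : exists J0, map_mx f J0 = JL.
  by apply: lift_map_mx => i j; rewrite mxE; apply: f_alg.
have [G0 G0E] : exists G0, map_mx f G0 = map_mx (in_alg L) G.
  by apply: lift_map_mx => i j; rewrite mxE; apply: f_alg.
have [Y0 Y0E] : exists Y0, map_mx f Y0 = Y.
  by apply: lift_map_mx => i j; apply: f_E; apply: Or31; exists i, j.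
have [U0 U0E] : exists U0, map_mx f U0 = u *m u^T.
  apply: lift_map_mx => i j; apply: f_E; apply: Or32; exists i, j.
  by rewrite mxE big_ord1 mxE.
have f_mx_inj m1 m2 (A B : 'M[K]_(m1, m2)) : map_mx f A = map_mx f B -> A = B.
  by move/matrixP => e; apply/matrixP => i j; apply: f_inj; have := e i j; rewrite !mxE.
have nat_unit k : exists v, k.+1%:R * v = 1 :> K.
  have [v fv] := f_alg (k.+1%:R^-1); exists v; apply: f_inj.
  rewrite rmorphM rmorph_nat rmorph1 fv -(rmorph_nat (in_alg L)) -rmorphM.
  by rewrite mulfV // rmorph1.
have poly_nat_unit k : exists v, k.+1%:R * v = 1 :> {poly K}.
  by have [v v1] := nat_unit k; exists v%:P; rewrite -polyC_natr -polyCM v1.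
have reg2 (x : {poly K}) : x + x = 0 -> x = 0.
  have [v v1] := poly_nat_unit 1%N.
  by rewrite -mulr2n -mulr_natl => h; rewrite -[x]mul1r -v1 mulrAC h mul0r.
pose C m1 m2 (A : 'M[K]_(m1, m2)) := map_mx (@polyC K) A.
(* The matrix ['X + J Y], written as a characteristic matrix so that [delta] is monic, hence
   regular. *)
pose S := char_poly_mx (- (J0 *m Y0)).
have SE : S = 'X%:M + C _ _ (J0 *m Y0) by rewrite /S /char_poly_mx map_mxN opprK.
have JG0 : J0 *m G0 = 1%:M.
  by apply: f_mx_inj; rewrite map_mxM J0E G0E -map_mxM JG !map_mx1.
have J0_skew : J0^T = - J0.
  by apply: f_mx_inj; rewrite map_mxN -map_trmx J0E map_trmx J_skew map_mxN.
have U0_skew : U0^T = - U0.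
  apply: f_mx_inj; rewrite map_mxN -map_trmx U0E.
  by apply/matrixP => i j; rewrite !mxE !big_ord1 !mxE u_anti.
have S_sym : S^T = S.
  rewrite SE linearD /= tr_scalar_mx /C map_trmx; congr (_ + map_mx _ _).
  by apply: f_mx_inj; rewrite -map_trmx map_mxM J0E Y0E.
pose fp : {rmorphism {poly K} -> {poly L}} := map_poly f.
have C_fp m1 m2 (A : 'M[K]_(m1, m2)) : map_mx fp (C _ _ A) = map_mx polyC (map_mx f A).
  by apply/matrixP => i j; rewrite !mxE /fp /= map_polyC.
(* Specialization at 0 is [coefp 0], which is a ring morphism even over the noncommutative [L]. *)
have evC m1 m2 (A : 'M[L]_(m1, m2)) : map_mx (coefp 0) (map_mx polyC A) = A.
  by apply/matrixP => i j; rewrite !mxE /= coefC.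
have evX : map_mx (coefp 0) ('X%:M : 'M[{poly L}]_n.+1) = 0.
  by apply/matrixP => i j; rewrite !mxE /= coefMn coefX mul0rn.
have evZ : map_mx (coefp 0) (block_mx 0 ((map_mx polyC u)^T *m map_mx fp (C _ _ J0))
   (map_mx polyC u) (map_mx fp (C _ _ G0 *m S))) = Z.
  rewrite map_block_mx map_mx0 evC map_mxM -map_trmx evC C_fp evC J0E; congr block_mx.
  rewrite map_mxM C_fp map_mxM evC SE map_mxD map_mxD map_scalar_mx /fp /= map_polyX.
  rewrite evX add0r -/fp C_fp evC G0E map_mxM J0E Y0E mulmxA -map_mxM.
  by rewrite (mulmx1C JG) map_mx1 mul1mx.
rewrite -evZ; apply: (@super_nilpotent_specialize _ _ fp n _ _ (map_mx polyC u) (C _ _ U0)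
  (C _ _ J0) (C _ _ G0) S _ _ _ _ _ _ K L f (coefp 0) (coefp 0)).
- by move=> x y /polyP e; apply/polyP => i; apply: f_inj; have := e i; rewrite !coef_map.
- exact: reg2.
- move=> i k; rewrite mxE; apply: comm_polyC_map => c; apply: f_comm; exact: uE_comm.
- move=> i j; rewrite !mxE /fp /= map_polyC -polyCM; congr _%:P.
  by have /matrixP/(_ i j) := U0E; rewrite !mxE big_ord1 mxE.
- by rewrite /C map_trmx U0_skew map_mxN.
- by rewrite /C map_trmx J0_skew map_mxN.
- exact: S_sym.
- by rewrite /C -map_mxM JG0 map_mx1.
- exact: f_inj.
- by move=> k; rewrite /fp /= coef_map.
- exact: poly_nat_unit.
- by apply/monic_lreg/monic_map/char_poly_monic.
- by rewrite evZ.
Qed.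

End OspNilpotent.

(** * Powers of a matrix with color-commuting entries *)

Section ColorMatrix.
Variables (L : nzRingType) (n : nat) (M : 'M[L]_n.+1).
Local Notation par i j := (parity i (+) parity j).
Hypothesis M_color : forall a b c d,
  scomm (~~ (par a b && par c d)) (M a b) (M c d).

Let color j l := forall a b c d,
  scomm ((odd j && odd l) (+) (par a b && par c d)) ((M ^+ j) a b) ((M ^+ l) c d).

(* [(M ^ j) a b] has degree [(j + par a b, par a b)] in Z/2 x Z/2, with commutation
   factor [(-1) ^ (e e' + e f' + e' f)] between the degrees [(e, f)] and [(e', f')]. *)
Lemma expr_color j l : color j l.
Proof.
have color0 k : color 0 k.
  move=> a b c d; rewrite expr0 mxE; case: eqP => [->|_]; last exact: scomm0l.
  by rewrite !addbb /= /scomm mul1r mulr1 mul1r.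
have colorS i k : color i k -> color 1 k -> color i.+1 k.
  move=> hi h1 a b c d; rewrite exprSr [X in scomm _ X _]mxE.
  apply: scomm_suml => e _; have := scommMl (hi a e c d) (h1 e b c d).
  rewrite expr1; congr (scomm _ _ _) => /=.
  by case: (odd i) (odd k) (parity a) (parity b) (parity c) (parity d) (parity e)
    => -[] [] [] [] [] [].
have colorC i k : color i k -> color k i.
  by move=> h a b c d; rewrite andbC (andbC (par a b)); apply/scomm_sym/h.
have color11 : color 1 1 by move=> a b c d; rewrite !expr1 /=; apply: M_color.
have color1 k : color k 1 by elim: k => // k IH; apply: colorS.
by elim: j => // j IH; apply: colorS => //; apply: colorC.
Qed.

Lemma strace_sign (W : 'M[L]_n.+1) : strace W = \sum_i (-1) ^+ parity i * W i i.
Proof.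
rewrite big_ord_recl mul1r /strace; congr (_ + _); rewrite -sumrN.
by apply: eq_bigr => i _; rewrite /= mulN1r.
Qed.

(** With [B] an odd power of [M], entries of [M] and [B] at transposed positions anticommute when
    the two index parities agree. When they differ the entries commute, but the sign in the
    supertrace flips. So the supertrace of [M B] is its own opposite. *)
Lemma strace_even_power k : (forall x : L, x + x = 0 -> x = 0) ->
  strace (M ^+ k.+1.*2) = 0.
Proof.
move=> reg2; apply: reg2; apply/eqP; rewrite addr_eq0; apply/eqP.
rewrite doubleS [in LHS]exprS [in RHS]exprSr !strace_sign -sumrN.
under eq_bigr do rewrite mxE mulr_sumr.
under [RHS]eq_bigr do rewrite mxE mulr_sumr -sumrN.
rewrite exchange_big; apply: eq_bigr => i _; apply: eq_bigr => j _ /=.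
have := expr_color k.*2.+1 1 i j j i; rewrite expr1 => /scomm_sym ->.
rewrite /= odd_double /= !mulr_sign.
by case: (parity i); case: (parity j); rewrite /= ?opprK.
Qed.

End ColorMatrix.

(** * The square of the generic matrix *)

Lemma skew_sum0 (F : fieldType) (L : algType F) n (J : 'M[F]_n) (x : 'I_n -> L) :
  (forall y : L, y + y = 0 -> y = 0) -> J^T = - J ->
  (forall i j, GRing.comm (x i) (x j)) -> \sum_i \sum_j J i j *: (x i * x j) = 0.
Proof.
move=> reg2 /matrixP Js xc; apply: reg2; rewrite {1}exchange_big -big_split big1 //= => i _.
rewrite -big_split big1 //= => j _.
by have := Js i j; rewrite !mxE => ->; rewrite (xc j i) scaleNr addNr.
Qed.

Section OddSquare.
Variables (F : fieldType) (L : algType F) (n : nat).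
Hypothesis char0 : [pchar F] =i pred0.
Variables (J G : 'M[F]_n.+1) (A : 'M[L]_n.+1) (v : 'cV[L]_n.+1).
Local Notation JL := (map_mx (in_alg L) J).
Hypotheses (J_skew : J^T = - J) (JG : J *m G = 1%:M).
Hypothesis JA_sym : (JL *m A)^T = JL *m A.
Let M : 'M[L]_(1 + n.+1) := block_mx 0 (v^T *m JL) v A.
Hypothesis M_color : forall a b c d,
  scomm (~~ ((parity a (+) parity b) && (parity c (+) parity d))) (M a b) (M c d).

Let reg2 (x : L) : x + x = 0 -> x = 0.
Proof.
have n2 : (2%:R : F) != 0 by have [/(_ char0) -> _] := pcharf0P F.
by rewrite -mulr2n -scaler_nat => /(congr1 ( *:%R (2%:R^-1))); rewrite scalerK // scaler0.
Qed.

Let JLmul m (W : 'M[L]_(n.+1, m)) i j : (JL *m W) i j = \sum_k J i k *: W k j.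
Proof. by rewrite mxE; apply: eq_bigr => k _; rewrite mxE -scalerAl mul1r. Qed.

Let mulJL m (W : 'M[L]_(m, n.+1)) i j : (W *m JL) i j = \sum_k J k j *: W i k.
Proof. by rewrite mxE; apply: eq_bigr => k _; rewrite mxE -scalerAr mulr1. Qed.

Let Jsk i j : J i j = - J j i.
Proof. by have /matrixP/(_ j i) := J_skew; rewrite !mxE. Qed.

Let AA i j k l : A i j * A k l = - (A k l * A i j).
Proof.
have := M_color (rshift 1 i) (rshift 1 j) (rshift 1 k) (rshift 1 l).
by rewrite !block_mxEdr /scomm /= mulN1r.
Qed.

Let Av i j k : A i j * v k 0 = - (v k 0 * A i j).
Proof.
have := M_color (rshift 1 i) (rshift 1 j) (rshift 1 k) (lshift n.+1 0).
by rewrite block_mxEdr block_mxEdl /scomm /= mulN1r.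
Qed.

Let vv i j : GRing.comm (v i 0) (v j 0).
Proof.
have := M_color (rshift 1 i) (lshift n.+1 0) (rshift 1 j) (lshift n.+1 0).
by rewrite !block_mxEdl /scomm /= mul1r.
Qed.

Let JLA_swap i j : \sum_k J i k *: A k j = \sum_k J j k *: A k i.
Proof. by rewrite -!JLmul -{1}JA_sym mxE. Qed.

Let u := A *m v.
Let Y := v *m (v^T *m JL) + A *m A.

(** The corner [v^T J v] vanishes since [J] is skew and the [v] commute. In the upper right block,
    the symmetry of [J A], the anticommutation of [A] with [v] and the skewness of [J] turn
    [v^T J A] into [(A v)^T J]. *)
Let M2 : M * M = block_mx 0 (u^T *m JL) u Y.
Proof.
rewrite -[M * M]/(M *m M) mulmx_block !(mul0mx, mulmx0, add0r, addr0); congr block_mx.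
- apply/matrixP => i j; rewrite !ord1 [RHS]mxE mxE -[RHS](skew_sum0 reg2 J_skew vv).
  rewrite exchange_big; apply: eq_bigr => k _; rewrite mulJL mulr_suml.
  by apply: eq_bigr => l _; rewrite mxE -scalerAl.
- apply/matrixP => i j; rewrite ord1 mulJL mxE.
  under eq_bigr do rewrite mulJL mulr_suml.
  rewrite exchange_big /=.
  transitivity (\sum_c \sum_k J j k *: (v c 0 * A k c)).
    apply: eq_bigr => c _; transitivity (v c 0 * \sum_k J j k *: A k c).
      rewrite -JLA_swap mulr_sumr; apply: eq_bigr => k _.
      by rewrite mxE -scalerAl -scalerAr.
    by rewrite mulr_sumr; apply: eq_bigr => k _; rewrite -scalerAr.
  rewrite exchange_big; apply: eq_bigr => k _; rewrite !mxE scaler_sumr.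
  by apply: eq_bigr => c _; rewrite Av Jsk scaleNr scalerN.
Qed.

Let Z_color a b c d :
  scomm ((parity a (+) parity b) && (parity c (+) parity d)) ((M * M) a b) ((M * M) c d).
Proof. by have := expr_color M_color 2 2 a b c d; rewrite expr2. Qed.

Let u_anti i j : u i 0 * u j 0 = - (u j 0 * u i 0).
Proof.
have := Z_color (rshift 1 i) (lshift n.+1 0) (rshift 1 j) (lshift n.+1 0).
by rewrite M2 !block_mxEdl /scomm /= mulN1r.
Qed.

Let uY_comm k i j : GRing.comm (u k 0) (Y i j).
Proof.
have := Z_color (rshift 1 k) (lshift n.+1 0) (rshift 1 i) (rshift 1 j).
by rewrite M2 block_mxEdl block_mxEdr /scomm /= mul1r.
Qed.

Let Y_comm i j k l : GRing.comm (Y i j) (Y k l).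
Proof.
have := Z_color (rshift 1 i) (rshift 1 j) (rshift 1 k) (rshift 1 l).
by rewrite M2 !block_mxEdr /scomm /= mul1r.
Qed.

(** [J v v^T J] is [- (J v) (J v)^T] with commuting entries. For [J A A], the sign from the
    anticommuting entries of [A] cancels the one from the skewness of [J]. *)
Let JY_sym : (JL *m Y)^T = JL *m Y.
Proof.
have vJ j : (v^T *m JL) 0 j = - (JL *m v) j 0.
  rewrite mulJL JLmul -sumrN; apply: eq_bigr => k _.
  by rewrite mxE Jsk scaleNr.
have Jv_comm i j : GRing.comm ((JL *m v) i 0) ((JL *m v) j 0).
  rewrite !JLmul; apply: commr_sum => k _; apply: commr_sym.
  apply: commr_sum => l _; rewrite /GRing.comm -!scalerAl -!scalerAr vv.
  by rewrite !scalerA mulrC.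
rewrite /Y mulmxDr !mulmxA linearD; congr (_ + _); apply/matrixP => i j.
  rewrite mxE -mulmxA mxE [RHS]mxE !big_ord1 !vJ !mulrN.
  by rewrite (Jv_comm _ _ : _ * _ = _ * _).
have AAE a b : (JL *m A *m A) a b = \sum_k \sum_l J k l *: (A l a * A k b).
  rewrite mxE; apply: eq_bigr => k _; rewrite -JA_sym mxE JLmul mulr_suml.
  by apply: eq_bigr => l _; rewrite -scalerAl.
rewrite mxE !AAE exchange_big; apply: eq_bigr => k _; apply: eq_bigr => l _.
by rewrite AA Jsk scaleNr scalerN opprK.
Qed.

(** For osp(1,2N) the size [n.+1] of [J] is 2N, so the exponent is 4N + 2. *)
Theorem odd_square_nilpotent : M ^+ n.+2.*2 = 0.
Proof.
rewrite -mul2n exprM expr2 M2; apply: (osp_super_nilpotent char0 J_skew JG) => // k.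
by rewrite -M2 -expr2 -exprM mul2n; apply: (strace_even_power M_color).
Qed.

End OddSquare.

(** * From osp(1,2n) to the generic matrix, and conclusion *)

Lemma in_osp_entry N (B X : 'M[CC]_N) (x : bool) i j : in_osp B x X ->
  \sum_c B c j * X c i + (-1) ^+ (x && parity i) * \sum_c B i c * X c j = 0.
Proof.
have homog_delta k : homog_vec (parity k) (delta_mx k 0 : 'cV[CC]_N).
  by move=> l; rewrite mxE; case: (altP (l =P k)) => [->|//]; rewrite eqxx.
have entry (W : 'M[CC]_N) :
    ((delta_mx i 0 : 'cV[CC]_N)^T *m W *m (delta_mx j 0 : 'cV[CC]_N)) 0 0 = W i j.
  by rewrite trmx_delta -mulmxA -colE -rowE !mxE.
move=> /(_ _ _ _ _ (homog_delta i) (homog_delta j)).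
rewrite /bform trmx_mul -(mulmxA _ X^T B) entry (mulmxA _ X) -(mulmxA _ B X).
rewrite entry !mxE => e; rewrite -[RHS]e; congr (_ + _).
by apply: eq_bigr => c _; rewrite mxE mulrC.
Qed.

(** The defining relation of osp is linear in [X], so it passes to [M] and gives the block form and
    the symmetry that [odd_square_nilpotent] asks for. *)
Lemma osp_generic_nilpotent (L : algType CC) n m (B : 'M[CC]_n.+2) (p : 'I_m -> bool)
    (X : 'I_m -> 'M[CC]_n.+2) (x : 'I_m -> L) :
  osp_form B -> (forall k, homog_mx (p k) (X k)) -> (forall k, in_osp B (p k) (X k)) ->
  (forall k l, scomm (~~ (p k && p l)) (x k) (x l)) ->
  (\sum_k tens (x k) (X k)) ^+ n.+2.*2 = 0.
Proof.
move=> [B_even _ B_odd detB] hhom hosp x_com.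
have char0 : [pchar CC] =i pred0 := Num.Theory.pchar_num _.
set M := \sum_k tens (x k) (X k).
have ME a b : M a b = \sum_k X k a b *: x k.
  by rewrite summxE; apply: eq_bigr => k _; rewrite mxE.
have M_color a b c' d' : scomm (~~ ((parity a (+) parity b) && (parity c' (+) parity d')))
    (M a b) (M c' d').
  rewrite !ME; apply: scomm_suml => k _; apply: scomm_sumr => l _.
  have [pk|/hhom->] := eqVneq (parity a (+) parity b) (p k); last first.
    by rewrite scale0r; apply: scomm0l.
  have [pl|/hhom->] := eqVneq (parity c' (+) parity d') (p l); last first.
    by rewrite scale0r; apply: scomm0r.
  by rewrite pk pl; apply: scomm_scale.
have M_lin (w : 'I_n.+2 -> CC) a : \sum_e w e *: M e a = \sum_k (\sum_e w e * X k e a) *: x k.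
  under eq_bigr do rewrite ME scaler_sumr.
  rewrite exchange_big; apply: eq_bigr => k _; rewrite scaler_suml.
  by apply: eq_bigr => e _; rewrite scalerA.
have M_osp a b : \sum_e B e b *: M e a +
    (-1) ^+ (parity a && ~~ parity b) *: \sum_e B a e *: M e b = 0.
  rewrite !M_lin scaler_sumr -big_split big1 //= => k _; rewrite scalerA -scalerDl.
  (* The sign may be read off the position instead of [p k]: when the two disagree, homogeneity of
     [X k] and evenness of [B] make both sums vanish. *)
  have [pk|pk] := eqVneq (parity a (+) parity b) (p k).
    have := in_osp_entry a b (hosp k); rewrite -pk.
    have -> : (parity a (+) parity b) && parity a = parity a && ~~ parity b.
      by case: (parity a) (parity b) => -[].
    by move=> ->; rewrite scale0r.
  rewrite !big1 ?mulr0 ?addr0 ?scale0r // => e _.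
    have [pe|/B_even->] := eqVneq (parity a) (parity e); last by rewrite mul0r.
    by rewrite (hhom k) ?mulr0 // -pe.
  have [pe|/B_even->] := eqVneq (parity e) (parity b); last by rewrite mul0r.
  by rewrite (hhom k) ?mulr0 // pe addbC.
pose r := lift (@ord0 n.+1).
pose b0 := B ord0 ord0.
have B0r i : B ord0 (r i) = 0 by apply: B_even.
have Br0 i : B (r i) ord0 = 0 by apply: B_even.
pose B1 : 'M[CC]_n.+1 := \matrix_(i, j) B (r i) (r j).
have [b0_neq0 B1_unit] : b0 != 0 /\ B1 \in unitmx.
  have BE : B = block_mx (b0%:M : 'M_1) 0 0 B1 :> 'M_(1 + n.+1).
    rewrite -[LHS](@submxK _ 1 n.+1 1 n.+1); congr block_mx; apply/matrixP => i j;
      rewrite !mxE ?ord1 ?rshift1 ?mulr1n //.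
    - by congr (B _ _); apply: val_inj.
    - by rewrite -(B0r j); congr (B _ _); apply: val_inj.
    - by rewrite -(Br0 i); congr (B _ _); apply: val_inj.
  have detE : \det B = b0 * \det B1.
    by rewrite {1}BE; apply: etrans (@det_ublock _ 1 n.+1 _ _ _) _; rewrite det_scalar1.
  move: detB; rewrite detE mulf_eq0 negb_or => /andP[-> ?].
  by rewrite unitmxE unitfE.
(* Normalized so that the relation at [(ord0, r j)] reads as row = [v^T J]. *)
pose J := (- b0^-1) *: B1.
have J_skew : J^T = - J.
  apply/matrixP => i j; rewrite !mxE [B (r j) _]B_odd // mulrN //.
have JG : J *m invmx J = 1%:M.
  by rewrite mulmxV // unitmxZ // unitfE oppr_eq0 invr_eq0.
have sumr (w : 'I_n.+2 -> L) : \sum_e w e = w ord0 + \sum_i w (r i) by rewrite big_ord_recl.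
have M00 : M ord0 ord0 = 0.
  have := M_osp ord0 ord0; rewrite /= scale1r !sumr.
  rewrite !big1 ?addr0; try by move=> i _; rewrite ?B0r ?Br0 scale0r.
  rewrite -mulr2n -scaler_nat scalerA => /eqP; rewrite scaler_eq0 mulf_eq0 (negbTE b0_neq0).
  by have [/(_ char0) -> _] := pcharf0P CC; rewrite /= => /eqP.
have M0r j : M ord0 (r j) = \sum_i J i j *: M (r i) ord0.
  have := M_osp ord0 (r j); rewrite /= scale1r !sumr B0r scale0r add0r.
  rewrite [X in _ + (_ + X)]big1 => [|i _]; last by rewrite B0r scale0r.
  rewrite addr0 => /eqP; rewrite addr_eq0 => /eqP sumE.
  transitivity (- b0^-1 *: \sum_i B (r i) (r j) *: M (r i) ord0).
    by rewrite sumE scaleNr scalerN opprK scalerA mulVf // scale1r.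
  by rewrite scaler_sumr; apply: eq_bigr => i _; rewrite !mxE scalerA.
have JM_sym i j : \sum_k J i k *: M (r k) (r j) = \sum_k J j k *: M (r k) (r i).
  have := M_osp (r i) (r j); rewrite /= scale1r !sumr B0r Br0 !scale0r !add0r.
  move=> /eqP; rewrite addrC addr_eq0 => /eqP sumE.
  transitivity (- b0^-1 *: \sum_k B (r i) (r k) *: M (r k) (r j)).
    by rewrite scaler_sumr; apply: eq_bigr => k _; rewrite !mxE scalerA.
  rewrite sumE -sumrN scaler_sumr; apply: eq_bigr => k _.
  by rewrite !mxE scalerN scalerA (B_odd (r j) (r k)) // mulrN scaleNr.
pose v : 'cV[L]_n.+1 := \col_i M (r i) ord0.
pose A : 'M[L]_n.+1 := \matrix_(i, j) M (r i) (r j).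
have lsh0 : lshift n.+1 0 = ord0 :> 'I_(1 + n.+1) by apply: val_inj.
have MblockE : M = block_mx 0 (v^T *m map_mx (in_alg L) J) v A :> 'M_(1 + n.+1).
  rewrite -[LHS](@submxK _ 1 n.+1 1 n.+1); congr block_mx; apply/matrixP => i j.
  - by rewrite !mxE !ord1 lsh0 M00.
  - rewrite !mxE ord1 lsh0 rshift1 M0r; apply: eq_bigr => k _.
    by rewrite !mxE -scalerAr mulr1.
  - by rewrite !mxE ord1 lsh0 rshift1.
  - by rewrite !mxE !rshift1.
rewrite MblockE; apply: (odd_square_nilpotent char0 J_skew JG); last by rewrite -MblockE.
apply/matrixP => i j; rewrite mxE !mxE.
have JLE a b : \sum_k map_mx (in_alg L) J a k * A k b = \sum_k J a k *: M (r k) (r b).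
  by apply: eq_bigr => k _; rewrite !mxE -scalerAl mul1r.
by rewrite !JLE JM_sym.
Qed.

(** Keeping [m] a variable tied to [n] by an equation avoids casts between ordinal types. *)
Lemma superA_eq0 n m (B : 'M[CC]_n.+1) (p : 'I_m -> bool) (X : 'I_m -> 'M[CC]_n.+1) :
  (0 < n)%N -> m = n.+1.*2 -> osp_form B -> (forall k, homog_mx (p k) (X k)) ->
  (forall k, in_osp B (p k) (X k)) -> superA p X = 0.
Proof.
case: n B X => // n B X _ mE hB hhom hosp.
(* [color_algebra] is indexed by natural numbers; [false] is a default beyond [m]. *)
pose q i := odflt false (omap p (insub i)).
have qE k : q (val k) = p k by rewrite /q valK.
have [|d [xi [sq0 com prod_neq0]]] := @color_algebra CC (fun i j => ~~ (q i && q j)) m.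
  by move=> i j; rewrite andbC.
pose x (k : 'I_m) := xi k.
have x_sq0 k : x k * x k = 0 by exact: sq0 _ (ltn_ord k).
have x_com k l : scomm (~~ (p k && p l)) (x k) (x l).
  by rewrite -!qE; apply: com; apply: ltn_ord.
have := osp_generic_nilpotent hB hhom hosp x_com.
rewrite -mE (expr_sum_tens X x_sq0 x_com) => /matrixP e.
(* Each entry of the vanishing power is an entry of [superA p X] times the nonzero product of the
   [x]. *)
apply/matrixP => i j; move/eqP: (e i j).
rewrite mxE [X in _ == X]mxE scaler_eq0 (negbTE prod_neq0) orbF => /eqP sA.
by rewrite [RHS]mxE.
Qed.

Theorem theorem5p1 (n : nat) (hn : (1 <= n)%N) (B : 'M[CC]_((2 * n)%N.+1))
  (hB : osp_form B)
  (p : 'I_(4 * n + 2)%N -> bool) (X : 'I_(4 * n + 2)%N -> 'M[CC]_((2 * n)%N.+1))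
  (hhom : forall k, homog_mx (p k) (X k))
  (hosp : forall k, in_osp B (p k) (X k)) :
  superA p X = 0.
Proof.
by apply: (superA_eq0 _ _ hB hhom hosp); lia.
Qed.
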